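(* Let $H$ be a complex Hilbert space, $B(H)$ the Banach space of bounded linear operators on $H$, $1<p<\infty$, $1/p+1/q=1$, and let $\mathbf T=(T_1,T_2,\dots)\in\ell^p_b(B(H))$. For $x,y\in H$ put $\langle\mathbf Tx,y\rangle=(\langle T_1x,y\rangle,\langle T_2x,y\rangle,\dots)$. The following are equivalent: (1) the operator $\mathbf T:\ell^q\to B(H)$, $\mathbf T\beta=\sum_{i=1}^\infty\beta_iT_i$, is compact; (2) the sequence $\mathbf T=(T_1,T_2,\dots)$ belongs to $\ell^p_c(B(H))$; (3) the set $\{\langle\mathbf Tx,y\rangle:x,y\in H,\ \|x\|=\|y\|=1\}$ is totally bounded in $\ell^p$; (4) the set $\{\langle\mathbf Tx,x\rangle:x\in H,\ \|x\|=1\}$ is totally bounded in $\ell^p$.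
   Context: For a complex Banach space $A$, let $A^*_1$ be the closed unit ball of the dual $A^*$, and for a sequence $\mathbf a=(a_1,a_2,\dots)$ in $A$ and $\phi\in A^*$ put $\phi(\mathbf a)=(\phi(a_1),\phi(a_2),\dots)$. $\ell^p_b(A)$ (resp. $\ell^p_c(A)$) is the set of all sequences $\mathbf a$ in $A$ such that $\{\phi(\mathbf a):\phi\in A^*_1\}$ is contained in $\ell^p$ and is a bounded (resp. totally bounded) subset of $\ell^p$. For $\mathbf T\in\ell^p_b(B(H))$ the series defining $\mathbf T\beta$ converges in operator norm for each $\beta\in\ell^q$; the same letter $\mathbf T$ denotes the sequence and the induced operator. *)

(* Defs.v *)
From HB Require Import structures.
From mathcomp Require Import all_boot all_order all_algebra.
From mathcomp Require Import all_classical all_reals all_analysis.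
From mathcomp Require Import complex.

Set Implicit Arguments.
Unset Strict Implicit.
Unset Printing Implicit Defensive.

Import Order.TTheory GRing.Theory Num.Theory.
Import numFieldNormedType.Exports.

Local Open Scope classical_set_scope.
Local Open Scope ring_scope.
Local Open Scope complex_scope.

Section BoundedOperators.
Context (R : realType) (E F : normedModType R[i]).

Definition bounded_op : {pred E -> F} := [pred f : E -> F |
  `[< linear f /\ exists M : R[i], forall x, `|f x| <= M * `|x| >] ].

Record bop : Type := Bop { bop_fun :> E -> F; _ : bop_fun \in bounded_op }.

HB.instance Definition _ := [isSub for bop_fun].
HB.instance Definition _ := [Choice of bop by <:].

Lemma bopP (f : bop) :
  linear f /\ exists M : R[i], forall x, `|f x| <= M * `|x|.
Proof. by case: f => f /= /asboolP. Qed.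

Lemma bounded_op_submod_closed : submod_closed bounded_op.
Proof.
split.
  apply/asboolP; split; first by move=> a x y /=; rewrite scaler0 addr0.
  by exists 0 => x; rewrite normr0 mul0r.
move=> a f g /asboolP[lf [M fM]] /asboolP[lg [N gN]]; apply/asboolP; split.
  move=> b x y; rewrite !fctE lf lg !scalerDr !scalerA addrACA.
  by rewrite [a * b]mulrC.
exists (`|a| * M + N) => x; rewrite (le_trans (ler_normD _ _))//.
by rewrite mulrDl lerD// normrZ -mulrA ler_wpM2l.
Qed.

HB.instance Definition _ :=
  GRing.isSubmodClosed.Build R[i] (E -> F) bounded_op bounded_op_submod_closed.
HB.instance Definition _ := [SubChoice_isSubLmodule of bop by <:].

HB.instance Definition _ (f : bop) :=
  GRing.isLinear.Build R[i] E F *:%R f (proj1 (bopP f)).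


(* The norm of a complex normed module is valued in R[i], whose order is
   partial; the supremum is therefore taken over the real parts. *)
Definition opnorm (f : bop) : R[i] :=
  (sup [set complex.Re `|f x| | x in [set x : E | `|x| <= 1]])%:C.

Lemma RRe_norm (V : normedModType R[i]) (v : V) : (complex.Re `|v|)%:C = `|v|.
Proof. exact: (RRe_real (normr_real v)). Qed.

Lemma bop_has_sup (f : bop) :
  has_sup [set complex.Re `|f x| | x in [set x : E | `|x| <= 1]].
Proof.
split; first by exists (complex.Re `|f 0|); exists 0 => //=; rewrite normr0.
have [_ [M fM]] := bopP f; exists (complex.Re `|M|) => _ [x x1 <-].
rewrite -lecR !RRe_norm (le_trans (fM x))//.
have Mx : M * `|x| \is Num.real by rewrite ger0_real// (le_trans _ (fM x)).
by rewrite (le_trans (real_ler_norm Mx))// normrM normr_id ler_piMr.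
Qed.

Lemma opnorm_ge0 (f : bop) : 0 <= opnorm f.
Proof.
rewrite /opnorm -[0]/(0%:C) lecR.
apply: (sup_upper_bound (bop_has_sup f)); exists 0 => /=; first by rewrite normr0.
by rewrite linear0 normr0.
Qed.

Lemma le_opnorm (f : bop) (x : E) : `|f x| <= opnorm f * `|x|.
Proof.
have [->|x0] := eqVneq x 0; first by rewrite linear0 !normr0 mulr0.
have nx : 0 < `|x| by rewrite normr_gt0.
rewrite -ler_pdivrMr// mulrC.
have -> : `|x|^-1 * `|f x| = `|f (`|x|^-1 *: x)|.
  by rewrite linearZ/= normrZ normfV normr_id.
rewrite -RRe_norm lecR; apply: (sup_upper_bound (bop_has_sup f)).
exists (`|x|^-1 *: x) => //=.
by rewrite normrZ normfV normr_id mulVf// gt_eqF.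
Qed.

Lemma opnorm_le (f : bop) (c : R[i]) : 0 <= c ->
  (forall x, `|f x| <= c * `|x|) -> opnorm f <= c.
Proof.
move=> c0 fc; rewrite -[c]RRe_real ?ger0_real// lecR.
apply: (ge_sup (proj1 (bop_has_sup f))) => _ [x /= x1 <-].
rewrite -lecR RRe_norm RRe_real ?ger0_real// (le_trans (fc x))//.
by rewrite ler_piMr.
Qed.

Lemma bop_addE (f g : bop) x : (f + g) x = f x + g x. Proof. by []. Qed.
Lemma bop_scaleE a (f : bop) x : (a *: f) x = a *: f x. Proof. by []. Qed.

Lemma opnormD (f g : bop) : opnorm (f + g) <= opnorm f + opnorm g.
Proof.
apply: opnorm_le => [|x]; first by rewrite addr_ge0 ?opnorm_ge0.
by rewrite bop_addE (le_trans (ler_normD _ _))// mulrDl lerD ?le_opnorm.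
Qed.

Lemma opnormZ_le a (f : bop) : opnorm (a *: f) <= `|a| * opnorm f.
Proof.
apply: opnorm_le => [|x]; first by rewrite mulr_ge0 ?opnorm_ge0.
by rewrite bop_scaleE normrZ -mulrA ler_wpM2l ?le_opnorm.
Qed.

Lemma opnormZ a (f : bop) : opnorm (a *: f) = `|a| * opnorm f.
Proof.
apply/le_anti; rewrite opnormZ_le/=.
have [->|a0] := eqVneq a 0; first by rewrite normr0 mul0r opnorm_ge0.
rewrite -ler_pdivlMl ?normr_gt0// -normfV.
by rewrite (le_trans _ (opnormZ_le _ _))// scalerA mulVf// scale1r.
Qed.

Lemma opnorm_eq0 (f : bop) : opnorm f = 0 -> f = 0.
Proof.
move=> f0; apply/val_inj/funext => x; apply/eqP; rewrite -normr_le0.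
by rewrite (le_trans (le_opnorm f x))// f0 mul0r.
Qed.

HB.instance Definition _ :=
  Lmodule_isNormed.Build R[i] bop opnormD opnormZ opnorm_eq0.

Lemma bop_normE (f : bop) : `|f| = opnorm f. Proof. by []. Qed.
End BoundedOperators.

Section BoundedOperatorsComplete.
Context (R : realType) (E : normedModType R[i]) (F : completeNormedModType R[i]).

Lemma bop_complete (G : set_system (bop E F)) :
  ProperFilter G -> cauchy G -> cvg G.
Proof.
move=> GF /cauchyP Gc.
have ball_near (g : bop E F) (e : R[i]) : G (ball g e) ->
    G [set f : bop E F | forall x, `|g x - f x| <= e * `|x|].
  apply: filterS => f; rewrite -ball_normE /ball_/= => gf x.
  by rewrite (le_trans (le_opnorm (g - f) x))// ler_wpM2r// ltW.
pose ev (x : E) (f : bop E F) : F := f x.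
pose l x := lim (ev x f @[f --> G]).
have lc x : ev x f @[f --> G] --> l x.
  apply: (@cauchy_cvg F (ev x f @[f --> G])); apply: cauchy_exP => e e0.
  have x1 : 0 < 1 + `|x| by rewrite ltr_pwDl.
  have d0 : 0 < e / (1 + `|x|) by rewrite divr_gt0.
  have [g /ball_near Gg] := Gc _ d0; exists (g x).
  apply: (@filterS _ G _ _ _ _ Gg) => f /= /(_ x) gf; rewrite -ball_normE /ball_/= /ev.
  rewrite (le_lt_trans gf)// -mulrA gtr_pMr// mulrC ltr_pdivrMr// mul1r.
  by rewrite ltrDr.
have ll : linear l.
  move=> a x y; apply: (norm_cvg_unique (lc _)).
  have cvl : a *: ev x f + ev y f @[f --> G] --> a *: l x + l y.
    by apply: cvgD; [apply: cvgZl_tmp; exact: lc|exact: lc].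
  suff <- : (fun f => a *: ev x f + ev y f) = ev (a *: x + y) by [].
  by apply/funext => f; rewrite /ev linearP.
have l0 : l 0 = 0 by have := ll (-1) 0 0; rewrite !scaleN1r !addNr.
have lg (g : bop E F) (e : R[i]) : 0 < e -> G (ball g e) ->
    forall x, `|g x - l x| <= e *+ 2 * `|x|.
  move=> e0 /ball_near Gg x.
  have [->|x0] := eqVneq x 0; first by rewrite l0 linear0 subrr !normr0 mulr0.
  have ex : 0 < e * `|x| by rewrite mulr_gt0 ?normr_gt0.
  have /cvgrPdist_lt/(_ _ ex) lx := lc x.
  have [f [gf lf]] := filter_ex (filterI Gg lx).
  rewrite -(subrKA (f x)) (le_trans (ler_normD _ _))// mulr2n mulrDl lerD//.
  by rewrite distrC ltW.
have lb : l \in @bounded_op R E F.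
  apply/asboolP; split=> //.
  have [g Gg] := Gc _ ltr01; exists (1 *+ 2 + opnorm g) => x.
  rewrite -[l x](subrK (g x)) (le_trans (ler_normD _ _))// mulrDl lerD//.
    by rewrite distrC lg.
  exact: le_opnorm.
apply/cvg_ex; exists (Bop lb); apply/cvg_ballP => e e0.
have e4 : 0 < e / 4%:R by rewrite divr_gt0.
have [g Gg] := Gc _ e4; near=> f.
have Gf : ball g (e / 4%:R) f by near: f.
rewrite -ball_normE /ball_/=.
have -> : Bop lb - f = (Bop lb - g) + (g - f) by rewrite subrKA.
have lgn : `|Bop lb - g| <= (e / 4%:R) *+ 2.
  rewrite distrC; apply: opnorm_le => [|x]; first by rewrite mulrn_wge0 ?ltW.
  exact: lg.
have gfn : `|g - f| < e / 4%:R by move: Gf; rewrite -ball_normE.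
rewrite (le_lt_trans (ler_normD _ _))// (lt_le_trans (ler_ltD lgn gfn))//.
rewrite [leRHS](_ : e = e / 4%:R *+ 4); last first.
  by rewrite -[_ *+ 4]mulr_natr divfK// pnatr_eq0.
by rewrite -mulrSr ler_wpMn2l// ltW.
Unshelve. all: by end_near. Qed.

HB.instance Definition _ := Uniform_isComplete.Build (bop E F) bop_complete.
End BoundedOperatorsComplete.

Section SequenceSpaces.
Context (R : realType).
Implicit Types (p q : R) (u v : nat -> R[i]) (S : set (nat -> R[i])).

Definition ell_norm p u : \bar R :=
  Lnorm counting p%:E (fun n => (complex.Re `|u n|)%:E).

Definition ell p : set (nat -> R[i]) := [set u | (ell_norm p u < +oo)%E].

Definition ell_bounded p S : Prop :=
  S `<=` ell p /\ exists M : R, forall u, S u -> (ell_norm p u <= M%:E)%E.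

Definition ell_totally_bounded p S : Prop :=
  S `<=` ell p /\
  forall e : R, 0 < e ->
    exists2 D : set (nat -> R[i]), finite_set D /\ D `<=` ell p &
      S `<=` \bigcup_(v in D) [set u | (ell_norm p (u \- v)%R < e%:E)%E].

Context (A : completeNormedModType R[i]).

Definition dual_range (a : nat -> A) : set (nat -> R[i]) :=
  [set (fun n => phi (a n)) | phi in [set phi : bop A (R[i])^o | `|phi| <= 1]].

Definition ell_b p (a : nat -> A) : Prop := ell_bounded p (dual_range a).
Definition ell_c p (a : nat -> A) : Prop := ell_totally_bounded p (dual_range a).

(* For a in ell_b p A and beta in ell q with 1/p + 1/q = 1 the series converges
   in A; elsewhere the limit may be a junk value. *)
Definition induced_op (a : nat -> A) (beta : nat -> R[i]) : A :=
  limn (series (fun i => beta i *: a i)).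

Definition ell_compact q (f : (nat -> R[i]) -> A) : Prop :=
  compact (closure (f @` [set beta | ell q beta /\ (ell_norm q beta <= 1)%E])).
End SequenceSpaces.

(* Main.v *)
Require Import Defs.
From HB Require Import structures.
From mathcomp Require Import all_boot all_order all_algebra.
From mathcomp Require Import finmap.
From mathcomp Require Import all_classical all_reals all_analysis.
From mathcomp Require Import complex.
From mathcomp Require Import ring lra.

(* A compact image of the unit ball gives a finite net (c_j); functionals of
   norm at most 1 that almost agree on the c_j almost agree on the whole image,
   and by the converse of Hoelder's inequality the corresponding sequences
   phi(T) are close in l^p.  This gives (1) -> (2).  Vector functionals
   S |-> <S x, y> have norm at most 1, so (2) -> (3) -> (4) are inclusions.
   For (4) -> (1), total boundedness makes the l^p tails of <T x, x> uniformly
   small, so by Hoelder's inequality the numerical radius of a block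
   sum_(m <= k < n) beta_k T_k is uniformly small for beta in the unit ball of
   l^q.  The norm of an operator is at most twice its numerical radius, hence T
   is a uniform limit of finite rank operators. *)

Set Implicit Arguments.
Unset Strict Implicit.
Unset Printing Implicit Defensive.

Import Order.TTheory GRing.Theory Num.Theory.
Import numFieldNormedType.Exports.

Local Open Scope classical_set_scope.
Local Open Scope ring_scope.
Local Open Scope complex_scope.

Local Notation rnorm v := (complex.Re `|v|).

(** * Norms on [ell p], Hoelder's inequality and its converse *)

Section SequenceNorms.
Context (R : realType).
Implicit Types (p q C e : R) (u b : nat -> R[i]).

Lemma rnormE (z : R[i]) : (rnorm z)%:C = `|z|.
Proof. exact: (RRe_real (normr_real z)). Qed.

Lemma rnorm_ge0 (z : R[i]) : 0 <= rnorm z.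
Proof. by have := normr_ge0 z; rewrite -rnormE lecR. Qed.

Lemma rnormM (z w : R[i]) : rnorm (z * w) = rnorm z * rnorm w.
Proof.
suff: (rnorm (z * w))%:C = (rnorm z * rnorm w)%:C by move=> [].
by rewrite [RHS]rmorphM/= !rnormE normrM. Qed.

Lemma rnorm_real (x : R) : rnorm x%:C = `|x|.
Proof.
by rewrite normc_def/= expr0n addr0 sqrtr_sqr.
Qed.

Lemma mul_conjC_rnorm (z : R[i]) : z * z^*%R = (rnorm z ^+ 2)%:C.
Proof. by rewrite -normCK -[in LHS](rnormE z) -rmorphXn. Qed.

(** The power map is increasing on nonnegative extended reals, and a series of nonnegative terms is
    bounded exactly when its partial sums are. Later estimates thus deal with finite real sums
    only. *)
Lemma ell_norm_leP p u C : 0 < p -> 0 <= C ->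
  (ell_norm p u <= C%:E)%E <->
  forall N, \sum_(0 <= k < N) rnorm (u k) `^ p <= C `^ p.
Proof.
move=> p0 C0; rewrite /ell_norm Lnorm_counting//.
under eq_eseriesr do rewrite poweR_EFin ger0_norm ?rnorm_ge0//.
set S := (X in (X `^ _)%E).
have uk0 k : (0 <= (rnorm (u k) `^ p)%:E)%E by rewrite lee_fin powR_ge0.
have S0 : (0 <= S)%E by apply: nneseries_ge0.
have SC : (S `^ p^-1 <= C%:E)%E <-> (S <= (C `^ p)%:E)%E.
  split=> h.
    have := @gt0_ler_poweR R p (ltW p0) (S `^ p^-1)%E C%:E.
    rewrite -poweRrM mulVf ?gt_eqF// poweRe1// poweR_EFin; apply => //.
      by rewrite in_itv/= poweR_ge0 leey.
    by rewrite in_itv/= lee_fin C0 leey.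
  have := @gt0_ler_poweR R p^-1 _ S (C `^ p)%:E.
  rewrite poweR_EFin -powRrM mulfV ?gt_eqF// powRr1//; apply => //.
  - by rewrite invr_ge0 ltW.
  - by rewrite in_itv/= S0 leey.
  - by rewrite in_itv/= lee_fin powR_ge0 leey.
rewrite SC; split=> [h N|h].
  rewrite -lee_fin -sumEFin (le_trans _ h)//.
  by apply: nneseries_lim_ge.
apply: lime_le; first exact: is_cvg_nneseries.
by apply: nearW => N; rewrite sumEFin lee_fin.
Qed.

Lemma ell_norm_fin p u : 0 < p -> ell p u ->
  exists2 C, 0 <= C & (ell_norm p u <= C%:E)%E.
Proof.
move=> p0 pu; exists (fine (ell_norm p u)).
  by rewrite fine_ge0// Lnorm_ge0.
by rewrite fineK// ge0_fin_numE// Lnorm_ge0.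
Qed.

Lemma ell_norm_sum_le p u C m n : 0 < p -> 0 <= C ->
  (ell_norm p u <= C%:E)%E ->
  \sum_(m <= k < n) rnorm (u k) `^ p <= C `^ p.
Proof.
move=> p0 C0 /(ell_norm_leP _ p0 C0)/(_ n); apply: le_trans.
have [mn|/ltnW nm] := leqP m n; last first.
  by rewrite (big_geq nm) sumr_ge0// => i _; exact: powR_ge0.
by rewrite (big_cat_nat (leq0n m) mn)//= lerDr sumr_ge0// => i _; exact: powR_ge0.
Qed.

Lemma ell_tail p u e : 0 < p -> 0 < e -> ell p u ->
  exists N, forall m n, (N <= m)%N ->
    \sum_(m <= k < n) rnorm (u k) `^ p <= e `^ p.
Proof.
move=> p0 e0 /(ell_norm_fin p0)[C C0 uC].
pose s := [series rnorm (u k) `^ p]_k.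
have snd : nondecreasing_seq s.
  by apply: nondecreasing_series => k _ _; exact: powR_ge0.
have cs : cvgn s.
  apply: nondecreasing_is_cvgn => //; exists (C `^ p) => _ [n _ <-].
  exact: (ell_norm_sum_le _ _ p0).
have /cauchy_seriesP/(_ _ (powR_gt0 p e0)) : cauchy (s @ \oo).
  exact: cvg_cauchy.
case=> -[A B] /= [[a _ Aa] [b _ Bb]] AB.
exists (maxn a b) => m n; rewrite geq_max => /andP[am bm].
have [mn|/ltnW nm] := leqP m n; last by rewrite big_geq// powR_ge0.
have /= := AB (m, n) (conj (Aa _ am) (Bb _ (leq_trans bm mn))).
by move/ltW; apply: le_trans; exact: ler_norm.
Qed.

(** Young's inequality is applied termwise to |u k| / C and |b k|; summing gives at most 1/p + 1/q =
    1. *)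
Lemma hoelder_sum p q C b u m n : 0 < p -> 0 < q -> p^-1 + q^-1 = 1 -> 0 < C ->
  \sum_(m <= k < n) rnorm (u k) `^ p <= C `^ p ->
  \sum_(m <= k < n) rnorm (b k) `^ q <= 1 ->
  `|\sum_(m <= k < n) b k * u k| <= C%:C.
Proof.
move=> p0 q0 pq C0 uC b1; rewrite (le_trans (ler_norm_sum _ _ _))//.
have -> : \sum_(m <= k < n) `|b k * u k| = (\sum_(m <= k < n) rnorm (b k * u k))%:C.
  by rewrite rmorph_sum/=; apply: eq_bigr => k _; rewrite rnormE.
rewrite lecR.
(* Each product is written as (|u k| / C) |b k| C, so that both factors are normalised. *)
under eq_bigr do rewrite rnormM mulrC -[X in X * _](divfK (lt0r_neq0 C0)) mulrAC.
rewrite -mulr_suml ler_piMl ?(ltW C0)//.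
have -> : 1 = 1 / p + 1 / q :> R by rewrite !div1r.
apply: (@le_trans _ _ (\sum_(m <= k < n)
    ((rnorm (u k) / C) `^ p / p + rnorm (b k) `^ q / q))).
  apply: ler_sum => k _; apply: conjugate_powR => //; rewrite ?rnorm_ge0//.
  by rewrite divr_ge0 ?rnorm_ge0 ?ltW.
rewrite big_split/= -!mulr_suml lerD// ler_wpM2r ?invr_ge0 ?(ltW p0) ?(ltW q0)//.
under eq_bigr do rewrite powRM ?rnorm_ge0 ?invr_ge0 ?(ltW C0)//.
rewrite -mulr_suml -powR_inv1 ?(ltW C0)// -powRrM mulN1r powRN.
by rewrite ler_pdivrMr ?powR_gt0// mul1r.
Qed.

(* The extremal vector is b k = conj (u k) |u k|^(p - 2) / S^(1/q), where S
   is the sum to be bounded. *)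
Lemma hoelder_converse p q C u N : 1 < p -> p^-1 + q^-1 = 1 -> 0 <= C ->
  (forall b, (ell_norm q b <= 1)%E -> (forall k, (N <= k)%N -> b k = 0) ->
    `|\sum_(0 <= k < N) b k * u k| <= C%:C) ->
  \sum_(0 <= k < N) rnorm (u k) `^ p <= C `^ p.
Proof.
move=> p1 pq C0 H.
have p0 : 0 < p by apply: lt_trans p1.
have q0 : 0 < q.
  rewrite -invr_gt0; have -> : q^-1 = 1 - p^-1 by rewrite -pq addrC addKr.
  by rewrite subr_gt0 invf_lt1.
set S := \sum_(0 <= k < N) _.
have S0 : 0 <= S by rewrite sumr_ge0// => k _; exact: powR_ge0.
have [SE|Sn0] := eqVneq S 0; first by rewrite SE powR_ge0.
have Sgt0 : 0 < S by rewrite lt_def Sn0.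
pose D := S `^ q^-1.
have D0 : 0 < D by exact: powR_gt0.
pose b k := if (k < N)%N then
  (u k)^*%R * ((rnorm (u k) `^ (p - 2) / D)%:C) else 0.
have nb k : (k < N)%N -> rnorm (b k) = rnorm (u k) `^ (p - 1) / D.
  move=> kN; rewrite /b kN rnormM rnorm_real (ger0_norm (divr_ge0 (powR_ge0 _ _) (ltW D0))).
  have -> : rnorm (u k)^*%R = rnorm (u k) by rewrite norm_conjC.
  rewrite mulrA; congr (_ / _).
  have [->|n0] := eqVneq (rnorm (u k)) 0.
    by rewrite mul0r powR0// subr_eq0 gt_eqF.
  rewrite -[X in X * _]powRr1 ?rnorm_ge0// -powRD ?n0 ?implybT//.
  by congr (_ `^ _); ring.
(* By this identity |b k|^q is |u k|^p / S, so these powers sum to 1 over k < N. *)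
have pq1 : (p - 1) * q = p.
  have := pq; move/(congr1 (fun x => x * (p * q))).
  rewrite mulrDl mul1r mulrA mulVf ?gt_eqF// mul1r [p * q]mulrC mulrA mulVf ?gt_eqF//.
  by move=> h; rewrite mulrBl mul1r mulrC -h; ring.
have bq k : (k < N)%N -> rnorm (b k) `^ q = rnorm (u k) `^ p / S.
  move=> kN; rewrite nb// powRM ?powR_ge0 ?invr_ge0 ?(ltW D0)// -powRrM pq1.
  congr (_ * _); rewrite -powR_inv1 ?(ltW D0)// -powRrM mulN1r powRN /D -powRrM mulVf ?gt_eqF//.
  by rewrite powRr1.
have nb0 k : (N <= k)%N -> rnorm (b k) `^ q = 0.
  by rewrite /b ltnNge => ->; rewrite normr0 powR0// gt_eqF.
have b1 : (ell_norm q b <= 1)%E.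
  apply/ell_norm_leP => // M; rewrite powR1.
  (* Partial sums are extended past [N], where the terms of [b] vanish. *)
  apply: (@le_trans _ _ (\sum_(0 <= k < maxn M N) rnorm (b k) `^ q)).
    rewrite [leRHS](big_cat_nat (leq0n _) (leq_maxl M N))//= lerDl.
    by rewrite sumr_ge0// => k _; exact: powR_ge0.
  rewrite (big_cat_nat (leq0n _) (leq_maxr M N))//=.
  rewrite [X in _ + X]big_nat_cond [X in _ + X]big1 ?addr0; last first.
    by move=> k /andP[/andP[Nk _] _]; exact: nb0.
  rewrite big_nat_cond; under eq_bigr => k /andP[/andP[_ kN] _] do rewrite bq//.
  by rewrite -big_nat_cond -mulr_suml divff.
have bN k : (N <= k)%N -> b k = 0 by rewrite /b ltnNge => ->.
have := H b b1 bN.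
have -> : \sum_(0 <= k < N) b k * u k = (S / D)%:C.
  rewrite /S mulr_suml rmorph_sum big_nat_cond [RHS]big_nat_cond.
  apply: eq_bigr => k /andP[/andP[_ kN] _]; rewrite /b kN.
  rewrite mulrAC [X in X * _]mulrC mul_conjC_rnorm.
  move: (rnorm (u k)) (rnorm_ge0 (u k)) => r r0; rewrite -rmorphM.
  apply: congr1; rewrite mulrA; congr (_ / _).
  have [->|n0] := eqVneq r 0.
    by rewrite expr0n mul0r powR0// gt_eqF.
  rewrite -powR_mulrn// -powRD ?n0 ?implybT//.
  by congr (_ `^ _); ring.
rewrite -[X in X <= _]rnormE lecR rnorm_real ger0_norm ?divr_ge0 ?(ltW D0)// => SDC.
(* Since 1 - 1/q = 1/p, the quotient S / D is S^(1/p). *)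
have -> : S = (S / D) `^ p.
  have -> : S / D = S `^ p^-1.
    rewrite /D -[X in X / _]powRr1// -powRB ?Sn0 ?implybT//.
    by congr (_ `^ _); rewrite -pq; ring.
  by rewrite -powRrM mulVf ?gt_eqF// powRr1.
by apply: ge0_ler_powR => //; rewrite ?nnegrE ?divr_ge0 ?(ltW D0) ?(ltW p0).
Qed.

End SequenceNorms.

(** * Finite codes for bounded families of scalars *)

Section FiniteCodes.
Context (R : realType).

(** Total boundedness of bounded sets in finite dimension, phrased as a finite colouring: cut
    [-M, M] into cells of length [e] and record the cell of each coordinate. Two values in the same
    cell differ by less than [e]. *)
Lemma bounded_real_code (X : Type) (I : finType) (f : I -> X -> R)
    (A : set X) (M e : R) : 0 < e ->
  (forall i x, A x -> `|f i x| <= M) ->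
  exists (K : finType) (c : X -> K), forall x y, A x -> A y -> c x = c y ->
    forall i, `|f i x - f i y| < e.
Proof.
(* The shift by [M] makes the quotient nonnegative on [A], where truncation is then the floor. *)
move=> e0 fM; pose g i x := Num.trunc ((f i x + M) / e).
pose L := Num.trunc ((M + M) / e).
have gL i x : A x -> (g i x < L.+1)%N.
  move=> /(fM i) /(le_trans (ler_norm _)) fiM; rewrite ltnS; apply: le_truncn.
  by rewrite ler_pM2r ?invr_gt0// lerD2r.
exists {ffun I -> 'I_L.+1}, (fun x => [ffun i => inord (g i x)]) => x y Ax Ay.
move=> /ffunP cxy i; move/(_ i): cxy; rewrite !ffunE => /(congr1 val)/=.
rewrite !inordK ?gL// => gxy.
have g0 z : A z -> 0 <= (f i z + M) / e.
  move=> /(fM i); rewrite ler_norml => /andP[fiM _].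
  by rewrite divr_ge0 ?(ltW e0)// -lerBlDr sub0r.
have /andP[x1 x2] := truncn_itv (g0 _ Ax).
have /andP[y1 y2] := truncn_itv (g0 _ Ay).
rewrite -/(g i x) -/(g i y) gxy -!natr1 in x1 x2 y1 y2.
rewrite ler_pdivlMr// in x1; rewrite ler_pdivlMr// in y1.
rewrite ltr_pdivrMr// mulrDl in x2; rewrite ltr_pdivrMr// mulrDl in y2.
rewrite ltr_norml; apply/andP; split; lra.
Qed.

Lemma le_rnorm_ReIm (z : R[i]) : rnorm z <= `|complex.Re z| + `|complex.Im z|.
Proof.
rewrite normc_def/= -[leRHS]ger0_norm ?addr_ge0// -sqrtr_sqr ler_wsqrtr//.
by rewrite sqrrD !real_normK ?num_real// lerD2r lerDl mulrn_wge0// mulr_ge0.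
Qed.

(** Real and imaginary parts are coded separately, each to precision e/2. *)
Lemma bounded_code (X : Type) (I : finType) (f : I -> X -> R[i])
    (A : set X) (M e : R) : 0 < e ->
  (forall i x, A x -> rnorm (f i x) <= M) ->
  exists (K : finType) (c : X -> K), forall x y, A x -> A y -> c x = c y ->
    forall i, rnorm (f i x - f i y) < e.
Proof.
move=> e0 fM; have e20 : 0 < e / 2 by rewrite divr_gt0.
have reM i x : A x -> `|complex.Re (f i x)| <= M.
  move=> /(fM i); apply: le_trans.
  rewrite normc_def/= -sqrtr_sqr ler_wsqrtr//.
  by rewrite lerDl sqr_ge0.
have imM i x : A x -> `|complex.Im (f i x)| <= M.
  move=> /(fM i); apply: le_trans.
  rewrite normc_def/= -sqrtr_sqr ler_wsqrtr//.
  by rewrite lerDr sqr_ge0.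
have [K1 [c1 H1]] := bounded_real_code e20 reM.
have [K2 [c2 H2]] := bounded_real_code e20 imM.
exists (K1 * K2)%type, (fun x => (c1 x, c2 x)) => x y Ax Ay [cx cy] i.
rewrite (le_lt_trans (le_rnorm_ReIm _))// !raddfB/= (splitr e).
by rewrite ltrD ?H1 ?H2.
Qed.

End FiniteCodes.

(** * Compactness through finite covers and finite nets *)

Section Compactness.
Context (R : realType) (V : completeNormedModType R[i]).

(** An ultrafilter containing the closure must contain one of finitely many small sets, at every
    scale; so it is Cauchy and converges by completeness. *)
Lemma compact_closure_small_covers (S : set V) :
  (forall e : R[i], 0 < e -> exists (K : finType) (F : K -> set V),
     S `<=` \bigcup_i F i /\
     forall i x y, F i x -> F i y -> `|x - y| < e) ->
  compact (closure S).
Proof.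
move=> cov; rewrite compact_ultra => G GU Gcl.
have GP : ProperFilter G by exact: ultra_proper.
have /cauchy_cvg/cvg_ex[l Gl] : cauchy G.
  apply: cauchy_exP => e e0; have e20 : 0 < e / 2%:R by rewrite divr_gt0.
  have [K [F [SF Fd]]] := cov _ e20.
  (* The pieces cover only [S]; enlarged by e/2 they cover its closure, where the ultrafilter
     lives. *)
  pose F' i := [set x | exists2 y, F i y & `|x - y| < e / 2%:R].
  have clF' : closure S `<=` \bigcup_i F' i.
    move=> x /(_ (ball x (e / 2%:R)) (nbhsx_ballx _ _ e20))[y []].
    move=> /SF[i _ Fiy]; rewrite -ball_normE => xy.
    by exists i => //; exists y.
  have [[i GFi]|noF] := pselect (exists i, G (F' i)); last first.
    have /filter_forall : forall i, G (~` F' i).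
      move=> i; have [GFi|//] := in_ultra_setVsetC (F' i) GU.
      by exfalso; apply: noF; exists i.
    move=> h; have [x [Hx /clF'[i _ Fx]]] := filter_ex (filterI h Gcl).
    by have := Hx i.
  have [_ [y Fy _]] := filter_ex GFi.
  exists y; apply: filterS GFi => x [z Fz xz]; rewrite -ball_normE /ball_/=.
  rewrite -(subrKA z) (le_lt_trans (ler_normD _ _))// (splitr e) ltrD//; first exact: (Fd i).
  by rewrite distrC.
exists l; split=> //; apply: (@closed_closure _ S) => B lB.
exact/filter_ex/(filterI Gcl (Gl _ lB)).
Qed.

Lemma compact_finite_net (S : set V) (e : R[i]) : 0 < e -> compact S ->
  exists s : seq V, forall x, S x -> exists2 y, y \in s & `|x - y| < e.
Proof.
move=> e0; rewrite compact_cover => /(_ V setT (fun x => (ball x e)°)).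
case=> [x _|x _|D _ SD]; first exact: open_interior.
  by exists x => //; exact: nbhsx_ballx.
exists (enum_fset D) => x /SD[y yD /interior_subset].
by rewrite -ball_normE /ball_/= distrC => xy; exists y.
Qed.

End Compactness.

(** * Cauchy-Schwarz, polarization and the numerical radius *)

Section InnerProduct.
Context (R : realType) (H : normedModType R[i]) (dot : {dot H for Num.conj}).
Context (dot_norm : forall x : H, dot x x = `|x| ^+ 2).

Lemma norm_dot_le x y : `|dot x y| <= `|x| * `|y|.
Proof.
have [->|y0] := eqVneq y 0; first by rewrite linear0r !normr0 mulr0.
have ny : 0 < `|y| by rewrite normr_gt0.
rewrite -ler_sqr ?nnegrE ?mulr_ge0//.
(* The vector [a *: y] is the projection of [x] onto the line of [y]; the squared length of the
   remainder is nonnegative. *)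
pose a := dot x y / `|y| ^+ 2.
have : 0 <= dot (x - a *: y) (x - a *: y) by exact: dnorm_ge0.
rewrite dnormB/= dnormZ linearZr_LR/= !dot_norm.
have aE : a^*%R * dot x y = `|dot x y| ^+ 2 / `|y| ^+ 2.
  rewrite /a rmorphM/= fmorphV rmorphXn/= (conj_Creal (normr_real _)) mulrAC.
  by rewrite [in LHS]mulrC [_^*%R * _]mulrC -normCK mulrC.
rewrite aE rmorphM/= fmorphV !rmorphXn/= !(conj_Creal (normr_real _)).
rewrite /a normrM normfV normrX !normr_id.
have -> : `|x| ^+ 2 + (`|dot x y| / `|y| ^+ 2) ^+ 2 * `|y| ^+ 2 -
  (`|dot x y| ^+ 2 / `|y| ^+ 2 + `|dot x y| ^+ 2 / `|y| ^+ 2) =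
  (`|x| ^+ 2 * `|y| ^+ 2 - `|dot x y| ^+ 2) / `|y| ^+ 2.
  by field; rewrite gt_eqF.
by rewrite pmulr_lge0 ?invr_gt0 ?exprn_gt0// subr_ge0 exprMn.
Qed.

Lemma dot_linear_expand (f : {linear H -> H}) (a : R[i]) x y :
  dot (f (x + a *: y)) (x + a *: y) =
  dot (f x) x + a^*%R * dot (f x) y + a * dot (f y) x + a * a^*%R * dot (f y) y.
Proof.
rewrite [f _]linearD [f (a *: y)]linearZ/= linearDl !linearDr/= !linearZl_LR/= !linearZr_LR/=.
by rewrite !addrA /GRing.scale/=; congr (_ + _); ring.
Qed.

(** The imaginary unit is a variable known only through its square and its conjugate, which keeps
    the identity within reach of [ring]. *)
Lemma polarization (i : R[i]) (f : {linear H -> H}) x y :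
  i ^+ 2 = -1 -> i^*%R = - i ->
  dot (f x) y *+ 4 =
  dot (f (x + 1 *: y)) (x + 1 *: y) - dot (f (x + (-1) *: y)) (x + (-1) *: y)
  + i * dot (f (x + i *: y)) (x + i *: y)
  - i * dot (f (x + (- i) *: y)) (x + (- i) *: y).
Proof.
move=> i2 ic; rewrite !dot_linear_expand rmorphN rmorph1 rmorphN/= ic opprK.
move: (dot (f x) y) (dot (f x) x) (dot (f y) x) (dot (f y) y) => d a b c.
(* The intermediate form keeps [i ^+ 2] unevaluated: one side needs its value, the other is a
   polynomial identity. *)
transitivity (d *+ 2 - i ^+ 2 * d *+ 2 + b *+ 2 + i ^+ 2 * b *+ 2).
  by rewrite i2; ring.
by ring.
Qed.

(** Expanding the four squares, the mixed terms cancel; this is the parallelogram law for two pairs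
    of points. *)
Lemma sum_norm_sqr (i : R[i]) (x y : H) : i ^+ 2 = -1 -> i^*%R = - i ->
  `|x + 1 *: y| ^+ 2 + `|x + (-1) *: y| ^+ 2 + `|x + i *: y| ^+ 2 +
  `|x + (- i) *: y| ^+ 2 = (`|x| ^+ 2 + `|y| ^+ 2) *+ 4.
Proof.
move=> i2 ic; rewrite -!dot_norm.
have E a := dot_linear_expand (idfun : {linear H -> H}) a x y.
rewrite /= in E; rewrite !E rmorphN rmorph1 rmorphN/= ic opprK.
move: (dot x y) (dot x x) (dot y x) (dot y y) => d a b c.
transitivity (a *+ 4 + c *+ 2 - i ^+ 2 * c *+ 2); first by ring.
by rewrite i2; ring.
Qed.

(** Polarization bounds four times the left side by [c] times the four squared norms, whose sum is 4
    (|x|^2 + |y|^2). *)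
Lemma norm_dot_le_diag (f : {linear H -> H}) (c : R[i]) x y :
  (forall z, `|dot (f z) z| <= c * `|z| ^+ 2) ->
  `|dot (f x) y| <= c * (`|x| ^+ 2 + `|y| ^+ 2).
Proof.
have [i [i2 ic ni]] : exists i : R[i], [/\ i ^+ 2 = -1, i^*%R = - i & `|i| = 1].
  by exists 'i%R; split; [exact: sqrCi|exact: conjCi|exact: normCi].
move=> fc; rewrite -(@ler_pMn2r _ 4)// -normrMn (polarization f x y i2 ic).
rewrite -mulrnAr -(sum_norm_sqr _ _ i2 ic) !mulrDr.
have tri (z1 z2 z3 z4 : R[i]) :
    `|z1 - z2 + i * z3 - i * z4| <= `|z1| + `|z2| + `|z3| + `|z4|.
  rewrite (le_trans (ler_normB _ _))// [X in _ + X]normrM ni mul1r lerD2r.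
  rewrite (le_trans (ler_normD _ _))// [X in _ + X]normrM ni mul1r lerD2r.
  exact: ler_normB.
apply: (le_trans (tri _ _ _ _)).
exact: lerD (lerD (lerD (fc _) (fc _)) (fc _)) (fc _).
Qed.

(** The diagonal estimate is tested on the multiple [y] of [f x] with |y| = |x|: it reads |x| |f x|
    <= 2 c |x|^2. *)
Lemma numerical_radius_le (f : bop H H) (c : R[i]) : 0 <= c ->
  (forall x, `|x| = 1 -> `|dot (f x) x| <= c) -> `|f| <= c *+ 2.
Proof.
move=> c0 fc.
(* By homogeneity the bound on unit vectors extends to all vectors. *)
have fc' x : `|dot (f x) x| <= c * `|x| ^+ 2.
  have [->|x0] := eqVneq x 0.
    by rewrite linear0r !normr0 expr0n mulr0.
  have nx : 0 < `|x| by rewrite normr_gt0.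
  rewrite -ler_pdivrMr ?exprn_gt0//.
  have := fc (`|x|^-1 *: x).
  rewrite normrZ normfV normr_id mulVf ?gt_eqF// => /(_ erefl).
  rewrite [f _]linearZ/= linearZl_LR/= linearZr_LR/= fmorphV/= (conj_Creal (normr_real _)).
  by rewrite !normrM normfV normr_id mulrA -invfM -expr2 mulrC.
apply: opnorm_le => [|x]; first by rewrite mulrn_wge0.
have [fx0|fx0] := eqVneq (f x) 0; first by rewrite fx0 normr0 mulr_ge0 ?mulrn_wge0.
have x0 : x != 0 by apply: contra_neq fx0 => ->; rewrite linear0.
have nx : 0 < `|x| by rewrite normr_gt0.
have nfx : 0 < `|f x| by rewrite normr_gt0.
pose y := (`|x| / `|f x|) *: f x.
have ny : `|y| = `|x|.
  by rewrite normrZ normrM normfV !normr_id divfK ?gt_eqF.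
have dy : dot (f x) y = `|x| * `|f x|.
  rewrite linearZr_LR/= dot_norm rmorphM/= fmorphV/= !(conj_Creal (normr_real _)).
  by field; rewrite gt_eqF.
have := norm_dot_le_diag x y fc'; rewrite dy normrM !normr_id.
rewrite ny -mulr2n.
have -> : c * (`|x| ^+ 2 *+ 2) = `|x| * (c *+ 2 * `|x|) by ring.
by rewrite ler_pM2l.
Qed.

End InnerProduct.

(** * Uniform tails of totally bounded sets of sequences *)

Section TotalBoundedness.
Context (R : realType).
Implicit Types (p q : R) (S : set (nat -> R[i])).

(** The centres of a net only have to lie in [ell p], so the same net serves the smaller set. *)
Lemma ell_totally_bounded_sub p S S' : S `<=` S' ->
  ell_totally_bounded p S' -> ell_totally_bounded p S.
Proof.
move=> SS' [S'p tb]; split=> [u /SS'/S'p//|e /tb[D Dp S'D]].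
by exists D => // u /SS'/S'D.
Qed.

Lemma ell_of_norm_le1 q (b : nat -> R[i]) : (ell_norm q b <= 1)%E -> ell q b.
Proof. by move=> b1; rewrite /ell/= (le_lt_trans b1)// ltry. Qed.

(** The finitely many centres of an e/2-net have a common tail index. Splitting [u] as [u - v] plus
    a nearby centre [v], Hoelder bounds each contribution by e/2. *)
Lemma uniform_tail p q S e : 0 < p -> 0 < q -> p^-1 + q^-1 = 1 -> 0 < e ->
  ell_totally_bounded p S ->
  exists N, forall u b m n, S u -> (ell_norm q b <= 1)%E -> (N <= m)%N ->
    `|\sum_(m <= k < n) b k * u k| <= e%:C.
Proof.
move=> p0 q0 pq e0 [_ tb]; have e20 : 0 < e / 2 by rewrite divr_gt0.
have [_ [/finite_fsetP[X ->] Xp] SX] := tb _ e20.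
(* The index is arbitrary, here 0, off the net, so that choice yields a function of all
   sequences. *)
have tail (v : nat -> R[i]) : exists N, v \in X -> forall m n, (N <= m)%N ->
    \sum_(m <= k < n) rnorm (v k) `^ p <= (e / 2) `^ p.
  have [vX|vX] := boolP (v \in X); last by exists 0%N.
  by have [N HN] := ell_tail p0 e20 (Xp _ vX); exists N.
have [Nv HN] := choice tail.
exists (\max_(v <- enum_fset X) Nv v)%N => u b m n Su b1 Xm.
have [v vX uv] := SX _ Su.
have bq : \sum_(m <= k < n) rnorm (b k) `^ q <= 1.
  by have := ell_norm_sum_le m n q0 ler01 b1; rewrite powR1.
have -> : \sum_(m <= k < n) b k * u k =
    \sum_(m <= k < n) b k * (u \- v) k + \sum_(m <= k < n) b k * v k.
  by rewrite -big_split; apply: eq_bigr => k _; rewrite /= -mulrDr subrK.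
rewrite (le_trans (ler_normD _ _))// (splitr e) rmorphD lerD//.
  apply: (hoelder_sum p0 q0) => //; apply: ell_norm_sum_le => //.
  - exact: ltW.
  - exact: ltW.
apply: (hoelder_sum p0 q0) => //; apply: HN => //.
by rewrite (leq_trans _ Xm)//; apply: leq_bigmax_seq.
Qed.

End TotalBoundedness.

(** * Compactness of the induced operator *)

Section InducedOperator.
Context (R : realType) (A : completeNormedModType R[i]).
Implicit Types (a : nat -> A) (p q : R).

Lemma re_norm_ge0 (x : A) : 0 <= rnorm x.
Proof. by have := normr_ge0 x; rewrite -RRe_norm lecR. Qed.

Lemma le_unit_functional (phi : bop A (R[i])^o) x : `|phi| <= 1 ->
  `|phi x| <= `|x|.
Proof.
by move=> phi1; rewrite (le_trans (le_opnorm phi x))// ler_piMl.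
Qed.

(** The partial sums are constant from [N] on. Through this the test vectors of the converse of
    Hoelder's inequality become points of the image of the unit ball. *)
Lemma induced_op_finite_support a (b : nat -> R[i]) N :
  (forall k, (N <= k)%N -> b k = 0) ->
  induced_op a b = \sum_(0 <= k < N) b k *: a k.
Proof.
move=> b0; apply: (lim_near_cst (@norm_hausdorff _ _)).
near=> n; have Nn : (N <= n)%N by near: n; exists N.
rewrite /series/= (big_cat_nat (leq0n N) Nn)/= [X in _ + X]big_nat_cond.
rewrite [X in _ + X]big1 ?addr0// => k /andP[/andP[Nk _] _].
by rewrite b0// scale0r.
Unshelve. all: by end_near. Qed.

(** Functionals are coded by their values on a finite net of the image. One representative per code,
    evaluated along [a], gives a finite net of the dual range. *)
Lemma ell_c_of_compact a p q : 1 < p -> p^-1 + q^-1 = 1 -> ell_b p a ->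
  ell_compact q (induced_op a) -> ell_c p a.
Proof.
move=> p1 pq [ap _] cpt; split=> // e e0.
have p0 : 0 < p by rewrite (lt_trans _ p1).
(* Three errors of size [d] will add up to 3e/4, which leaves the strict inequality. *)
pose d := e / 4; have d0 : 0 < d by rewrite divr_gt0.
have dC0 : 0 < d%:C by rewrite ltcR.
have [s net] := compact_finite_net dC0 cpt.
pose ball1 : set (bop A (R[i])^o) := [set phi | `|phi| <= 1].
pose f (j : 'I_(size s)) (phi : bop A (R[i])^o) : R[i] := phi (nth 0 s j).
have fM j phi : ball1 phi -> rnorm (f j phi) <= \sum_(i < size s) rnorm (nth 0 s i).
  move=> phi1; have : rnorm (nth 0 s j) <= \sum_(i < size s) rnorm (nth 0 s i).
    rewrite (bigD1 j)//= lerDl sumr_ge0// => i _.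
    exact: re_norm_ge0.
  apply: le_trans; rewrite -lecR RRe_norm rnormE.
  exact: le_unit_functional.
have [K [c Hc]] := bounded_code d0 fM.
(* A functional with code [k]; the default 0 occurs only for codes that no functional of the ball
   has. *)
pose rep k := xget 0 [set phi | ball1 phi /\ c phi = k].
have repP phi : ball1 phi -> ball1 (rep (c phi)) /\ c (rep (c phi)) = c phi.
  by move=> phi1; rewrite /rep; case: xgetP => [psi _ []//|/(_ phi)/= []].
exists [set (fun n => rep k (a n)) | k in [set c phi | phi in ball1]].
  split; first by apply: finite_image; exact: finite_finset.
  move=> _ [_ [phi phi1 <-] <-]; apply: ap.
  by exists (rep (c phi)) => //; have [] := repP _ phi1.
move=> _ [phi phi1 <-]; exists (fun n => rep (c phi) (a n)).
  by exists (c phi) => //; exists phi.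
have [psi1 cpsi] := repP _ phi1; move: (rep _) psi1 cpsi => psi psi1 cpsi /=.
apply: (@le_lt_trans _ _ (d *+ 3)%:E); last first.
  by rewrite lte_fin /d -mulr_natr -mulrA gtr_pMr//; lra.
have d30 : 0 <= d *+ 3 by rewrite mulrn_wge0// ltW.
(* It remains to compare [phi] and [psi] at images of finitely supported [b] in the unit ball. *)
apply/ell_norm_leP => // N; apply: (hoelder_converse p1 pq) => // b b1 b0.
have -> : \sum_(0 <= k < N) b k * ((fun n => phi (a n)) \- (fun n => psi (a n))) k =
    phi (induced_op a b) - psi (induced_op a b).
  rewrite (induced_op_finite_support a b0) !linear_sum/= -big_split.
  by apply: eq_bigr => k _; rewrite !linearZ; exact: mulrDr.
have [|x xs xd] := net (induced_op a b).
  by apply: subset_closure; exists b => //; split => //; exact: ell_of_norm_le1.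
(* Pass through the net point [x]: the outer terms are small as both functionals have norm at most
   1, the middle one as their codes agree. *)
have -> : phi (induced_op a b) - psi (induced_op a b) =
    phi (induced_op a b - x) + (phi x - psi x) - psi (induced_op a b - x) :> R[i].
  by rewrite !linearB/=; ring.
have phid chi : ball1 chi -> `|chi (induced_op a b - x)| <= d%:C.
  by move=> chi1; rewrite (le_trans (le_unit_functional _ chi1))// ltW.
have xpsi : `|phi x - psi x| <= d%:C.
  have jx : (index x s < size s)%N by rewrite index_mem.
  have := Hc _ _ phi1 psi1 (esym cpsi) (Ordinal jx).
  by rewrite /f/= nth_index// => /ltW; rewrite -lecR rnormE.
rewrite rmorphMn/= !mulrS mulr0n addr0 addrA.
rewrite (le_trans (ler_normB _ _))// lerD ?phid//.
by rewrite (le_trans (ler_normD _ _))// lerD ?phid.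
Qed.

(** Up to a uniform error the image of [b] depends only on its first [N] coordinates. Coding these
    coordinates covers the image by finitely many small sets. *)
Lemma compact_of_uniform_tail a q : 0 < q ->
  (forall e, 0 < e -> exists N, forall b m n, (ell_norm q b <= 1)%E ->
    (N <= m)%N -> `|\sum_(m <= k < n) b k *: a k| <= e%:C) ->
  ell_compact q (induced_op a).
Proof.
move=> q0 tail; apply: compact_closure_small_covers => e e0.
(* A positive element of [R[i]] is real, so the tail hypothesis, stated for real bounds, applies. *)
have -> : e = (complex.Re e)%:C by rewrite RRe_real// ger0_real// ltW.
have r0 : 0 < complex.Re e by move: e0; rewrite ltcE => /andP[].
move: (complex.Re e) r0 => r r0 {e e0}.
(* The final estimate is 2d + d + 2d = 5d < r. *)
pose d := r / 6; have d0 : 0 < d by rewrite divr_gt0.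
have [N HN] := tail _ d0.
have near_partial b : (ell_norm q b <= 1)%E ->
    `|induced_op a b - \sum_(0 <= k < N) b k *: a k| <= (d *+ 2)%:C.
  (* Uniform tails make the series Cauchy, so [induced_op a b] is a genuine limit. One [d] pays for
     reaching a late partial sum, one for the block after [N]. *)
  move=> b1; have : cvgn (series (fun k => b k *: a k)).
    apply/cauchy_cvgP/cauchy_seriesP => e e0.
    have eE : e = (complex.Re e)%:C by rewrite RRe_real// ger0_real// ltW.
    have r'0 : 0 < complex.Re e / 2.
      by rewrite divr_gt0//; move: e0; rewrite ltcE => /andP[].
    have [M HM] := tail _ r'0.
    exists ([set n | (M <= n)%N], [set: nat]) => /=.
      by split; [exists M|exact: filterT].
    move=> [m n] /= [Mm _]; rewrite (le_lt_trans (HM _ _ _ b1 Mm))// eE ltcR.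
    by rewrite gtr_pMr ?invf_lt1 ?ltr1n//; move: e0; rewrite ltcE => /andP[].
  have dC0 : 0 < d%:C by rewrite ltcR.
  move=> /cvgrPdist_lt/(_ _ dC0)[n0 _ Hn0].
  have /= Hn := Hn0 _ (leq_maxl n0 N).
  rewrite -(subrKA (\sum_(0 <= k < maxn n0 N) b k *: a k)) mulr2n rmorphD.
  rewrite (le_trans (ler_normD _ _))// lerD//; first exact: ltW.
  rewrite (big_cat_nat (leq0n N) (leq_maxr n0 N))/= addrAC subrr add0r.
  exact: HN.
pose ball1 : set (nat -> R[i]) := [set b | (ell_norm q b <= 1)%E].
have bM (j : 'I_N) (b : nat -> R[i]) : ball1 b -> rnorm (b j) <= 1.
  move=> /(ell_norm_sum_le j j.+1 q0 ler01); rewrite big_nat1 powR1 => bj.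
  have := @ge0_ler_powR R q^-1 _ (rnorm (b j) `^ q) 1.
  rewrite powR1 -powRrM mulfV ?gt_eqF// powRr1 ?rnorm_ge0//; apply => //.
  - by rewrite invr_ge0 ltW.
  - by rewrite nnegrE powR_ge0.
  - by rewrite nnegrE.
pose s := \sum_(0 <= k < N) rnorm (a k).
have s0 : 0 <= s by apply: sumr_ge0 => k _; exact: re_norm_ge0.
(* Coordinates this close change the partial sum by at most d s / (1 + s) <= d; the added 1 keeps
   the denominator positive. *)
have ds0 : 0 < d / (1 + s) by rewrite divr_gt0// ltr_pwDl.
have [K [c Hc]] := bounded_code ds0 bM.
exists K, (fun k => [set induced_op a b | b in [set b | ball1 b /\ c b = k]]).
split=> [_ [b [_ b1] <-]|_ _ _ [b [b1 <-] <-] [b' [b'1 cb] <-]].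
  by exists (c b) => //; exists b.
have bb' : `|\sum_(0 <= k < N) b k *: a k - \sum_(0 <= k < N) b' k *: a k| <= d%:C.
  rewrite -sumrB (le_trans (ler_norm_sum _ _ _))//.
  apply: (@le_trans _ _ (\sum_(0 <= k < N) (d / (1 + s))%:C * `|a k|)).
    rewrite !big_mkord; apply: ler_sum => k _; rewrite -scalerBl normrZ.
    by rewrite ler_wpM2r// -rnormE lecR ltW// Hc.
  rewrite -mulr_sumr; under eq_bigr do rewrite -RRe_norm.
  rewrite -rmorph_sum -rmorphM lecR -/s -mulrA ger_pMr// mulrC.
  by rewrite ler_pdivrMr ?mul1r ?lerDr// ltr_pwDl.
apply: (@le_lt_trans _ _ (d *+ 2 + d + d *+ 2)%:C); last first.
  by rewrite ltcR /d; lra.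
have -> : induced_op a b - induced_op a b' =
  (induced_op a b - \sum_(0 <= k < N) b k *: a k) +
  (\sum_(0 <= k < N) b k *: a k - \sum_(0 <= k < N) b' k *: a k) -
  (induced_op a b' - \sum_(0 <= k < N) b' k *: a k).
  by rewrite subrKA opprB subrKA.
rewrite (rmorphD _ (d *+ 2 + d)) (rmorphD _ (d *+ 2) d).
rewrite (le_trans (ler_normB _ _))// lerD ?near_partial//.
by rewrite (le_trans (ler_normD _ _))// lerD ?near_partial.
Qed.

End InducedOperator.

(** * Vector functionals on the space of operators *)

Section OperatorSequences.
Context (R : realType) (H : completeNormedModType R[i]).
Context (dot : {dot H for Num.conj}).
Context (dot_norm : forall x : H, dot x x = `|x| ^+ 2).

(** Cauchy-Schwarz gives the norm bound. These functionals place the set of (3) inside the dual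
    range of [T]. *)
Lemma vector_functional (x y : H) : `|x| = 1 -> `|y| = 1 ->
  exists2 phi : bop (bop H H) (R[i])^o, `|phi| <= 1 &
    forall f, phi f = dot (f x) y.
Proof.
move=> x1 y1; pose phi (f : bop H H) : (R[i])^o := dot (f x) y.
have phi_le f : `|phi f| <= 1 * `|f|.
  rewrite mul1r (le_trans (norm_dot_le dot_norm _ _))// y1 mulr1.
  by rewrite (le_trans (le_opnorm f x))// x1 mulr1.
have phiP : phi \in @bounded_op R (bop H H) (R[i])^o.
  apply/asboolP; split; last by exists 1.
  by move=> c f g; rewrite /phi linearDl linearZl_LR.
by exists (Bop phiP) => //; apply: opnorm_le.
Qed.

Lemma bop_sumE (F : nat -> bop H H) (m n : nat) x :
  (\sum_(m <= k < n) F k) x = \sum_(m <= k < n) F k x.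
Proof. by apply: (big_morph (fun f : bop H H => f x)). Qed.

End OperatorSequences.

(** * The cycle of implications (1) -> (2) -> (3) -> (4) -> (1) *)

Theorem theorem5p1 (R : realType)
    (H : completeNormedModType R[i])
    (dot : {dot H for Num.conj})
    (dot_norm : forall x : H, dot x x = `|x| ^+ 2)
    (p q : R) (p_gt1 : 1 < p) (pq : p^-1 + q^-1 = 1)
    (T : nat -> bop H H) (Tb : ell_b p T) :
  [<-> ell_compact q (induced_op T);
       ell_c p T;
       ell_totally_bounded p
         [set u | exists x y : H,
            [/\ `|x| = 1, `|y| = 1 & u = (fun n => dot (T n x) y)]];
       ell_totally_bounded p
         [set u | exists x : H,
            `|x| = 1 /\ u = (fun n => dot (T n x) x)]].
Proof.
have p0 : 0 < p by rewrite (lt_trans _ p_gt1).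
have q0 : 0 < q.
  rewrite -invr_gt0; have -> : q^-1 = 1 - p^-1 by rewrite -pq addrC addKr.
  by rewrite subr_gt0 invf_lt1.
tfae.
- exact: ell_c_of_compact.
- apply: ell_totally_bounded_sub => _ [x [y [x1 y1 ->]]].
  have [phi phi1 phiE] := vector_functional dot_norm x1 y1.
  by exists phi => //; apply/funext => n; rewrite phiE.
- by apply: ell_totally_bounded_sub => _ [x [x1 ->]]; exists x, x.
move=> tb; apply: compact_of_uniform_tail => // e e0.
(* Half of [e], because passing from numerical radius to norm costs a factor 2. *)
have e20 : 0 < e / 2 by rewrite divr_gt0.
have [N HN] := uniform_tail p0 q0 pq e20 tb.
exists N => b m n b1 Nm.
have -> : e%:C = (e / 2)%:C *+ 2 by rewrite mulr2n -rmorphD -splitr.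
apply: (numerical_radius_le dot_norm) => [|x x1]; first by rewrite lecR ltW.
(* The quadratic form of a block is the pairing of [b] with a sequence from the set of (4), which
   the uniform tail bound controls. *)
have -> : dot ((\sum_(m <= k < n) b k *: T k) x) x =
    \sum_(m <= k < n) b k * dot (T k x) x.
  rewrite bop_sumE (big_morph (dot^~ x) (linearDl _ _) (linear0l _ _)).
  by apply: eq_bigr => k _; rewrite bop_scaleE linearZl_LR.
by apply: (HN (fun k => dot (T k x) x)) => //; exists x.
Qed.
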